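(* There is no almost periodic infinite word $\alpha$ such that $\mathrm{Sub}(\alpha)$ is a context-free non-regular language. That is, for every finite alphabet $V$ and every almost periodic $\alpha$ in $V^{\omega}$ or in $V^{\omega^{*}+\omega}$, if $\mathrm{Sub}(\alpha)$ is context-free, then $\mathrm{Sub}(\alpha)$ is regular.
   Context: $V^{\omega}$ denotes the set of one-sided infinite words over the finite alphabet $V$ and $V^{\omega^{*}+\omega}$ the set of two-sided infinite words over $V$. For an infinite word $\alpha$, $\mathrm{Sub}(\alpha)$ is the language of its finite (contiguous) factors, including the empty word. An infinite word $\alpha$ (one-sided or two-sided) is almost periodic if for every finite factor $w$ of $\alpha$ there exists a positive integer $n_w$ such that every finite factor $z$ of $\alpha$ of length at least $n_w$ has $w$ as a factor. *)

(* Defs.v *)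
From mathcomp Require Import all_boot all_order all_algebra.
From Stdlib Require Export Relation_Operators.
Set Implicit Arguments.
Unset Strict Implicit.
Unset Printing Implicit Defensive.

Definition language (V : Type) := seq V -> Prop.

Record dfa (V : finType) := Dfa {
  dfa_state : finType;
  dfa_init : dfa_state;
  dfa_final : {set dfa_state};
  dfa_trans : dfa_state -> V -> dfa_state
}.

Definition dfa_accept (V : finType) (A : dfa V) (w : seq V) : bool :=
  foldl (@dfa_trans V A) (dfa_init A) w \in dfa_final A.

Definition regular (V : finType) (L : language V) : Prop :=
  exists A : dfa V, forall w, L w <-> dfa_accept A w.

(* In sentential forms [inl A] is a nonterminal and [inr a] a terminal. The
   right-hand side of a production may be empty. *)
Record cfg (V : finType) := Cfg {
  cfg_nonterm : finType;
  cfg_start : cfg_nonterm;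
  cfg_prods : seq (cfg_nonterm * seq (cfg_nonterm + V))
}.

Inductive cfg_step (V : finType) (G : cfg V) :
    seq (cfg_nonterm G + V) -> seq (cfg_nonterm G + V) -> Prop :=
  CfgStep (A : cfg_nonterm G) (r u v : seq (cfg_nonterm G + V)) :
    (A, r) \in cfg_prods G -> cfg_step (u ++ inl A :: v) (u ++ r ++ v).

Definition cfg_generates (V : finType) (G : cfg V) (w : seq V) : Prop :=
  clos_refl_trans _ (@cfg_step V G) [:: inl (cfg_start G)]
    [seq inr a | a <- w].

Definition context_free (V : finType) (L : language V) : Prop :=
  exists G : cfg V, forall w, L w <-> cfg_generates G w.

(* Two-sided words are represented with a chosen origin; everything below is
   invariant under shifting it. *)
Inductive infinite_word (V : Type) :=
| OneSided of nat -> V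
| TwoSided of int -> V.

(* Sub(alpha): the finite factors of alpha. *)
Definition factors (V : Type) (alpha : infinite_word V) : language V := fun w =>
  match alpha with
  | OneSided f => exists i : nat, w = mkseq (fun k => f (i + k)) (size w)
  | TwoSided f => exists i : int, w = mkseq (fun k => f (i + k%:Z)%R) (size w)
  end.

Definition almost_periodic (V : finType) (alpha : infinite_word V) : Prop :=
  forall w, factors alpha w ->
  exists n : nat, 0 < n /\
    forall z, factors alpha z -> n <= size z -> infix w z.

(* Main.v *)
Require Import Defs.
From mathcomp Require Import all_boot ssralg ssrint.
From Stdlib Require Import Operators_Properties.

Set Implicit Arguments.
Unset Strict Implicit.
Unset Printing Implicit Defensive.

(** A factor-closed context-free language with arbitrarily long words contains,
    by pumping, all the powers of some nonempty word [v].  Almost periodicity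
    makes every factor of [alpha] a factor of a long enough power of [v], so
    that the factors of [alpha] are exactly those of the periodic word
    [v v v ...], and these are recognized by a finite automaton that keeps track
    of the set of possible current positions modulo [size v]. *)

(** * Powers and factors of finite words *)

Lemma flatten_nseqSr (T : Type) n (s : seq T) :
  flatten (nseq n.+1 s) = flatten (nseq n s) ++ s.
Proof. by elim: n => [|n IH]; rewrite /= ?cats0 // -catA -IH. Qed.

Lemma mkseqD (T : Type) (f : nat -> T) m n :
  mkseq f (m + n) = mkseq f m ++ mkseq (fun k => f (m + k)) n.
Proof. by rewrite /mkseq iotaD map_cat add0n -{2}[m]addn0 iotaDl -map_comp. Qed.

Lemma infix_mkseq (T : eqType) (f : nat -> T) n w :
  infix w (mkseq f n) -> exists i, w = mkseq (fun k => f (i + k)) (size w).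
Proof.
case/infixP=> s [s' E]; exists (size s).
have := congr1 size E; rewrite size_mkseq !size_cat => En.
move: E; rewrite En !mkseqD => /eqP.
rewrite eqseq_cat ?size_mkseq // => /andP[_].
by rewrite eqseq_cat ?size_mkseq // => /andP[/eqP<-]; rewrite size_mkseq.
Qed.

(** * Derivation trees and pumping for context-free grammars *)

Section Pumping.

Variables (V : finType) (G : cfg V).

Local Notation sform := (seq (cfg_nonterm G + V)).
Local Notation terminals w := ([seq inr a | a <- w] : sform).
Local Notation derives := (clos_refl_trans sform (@cfg_step V G)).

Lemma derives_trans (t s u : sform) : derives s t -> derives t u -> derives s u.
Proof. exact: rt_trans. Qed.

Lemma derives_ctx (p q s t : sform) :
  derives s t -> derives (p ++ s ++ q) (p ++ t ++ q).
Proof.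
elim=> [_ _ [A r u v rP]|?|? t' ? _ IH1 _ IH2]; last exact: derives_trans IH2.
- rewrite -!catA /= !(catA p u); exact/rt_step/CfgStep.
- exact: rt_refl.
Qed.

Lemma derives_prod A (r : sform) : (A, r) \in cfg_prods G -> derives [:: inl A] r.
Proof.
by move=> rP; rewrite -[r]cats0; apply/rt_step/(CfgStep [::] [::]).
Qed.

Lemma derives_cat (s s' t t' : sform) :
  derives s s' -> derives t t' -> derives (s ++ t) (s' ++ t').
Proof.
move=> ss' tt'; apply: (@derives_trans (s' ++ t)).
  exact: (derives_ctx [::] t ss').
by have := derives_ctx s' [::] tt'; rewrite !cats0.
Qed.

(* [yields n s w]: the form [s] is the list of roots of a forest of derivation
   trees of height at most [n] whose leaves spell [w]. *)
Inductive yields : nat -> sform -> seq V -> Prop :=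
| YieldsNil n : yields n [::] [::]
| YieldsTerminal n a s w : yields n s w -> yields n (inr a :: s) (a :: w)
| YieldsProd n A r s w1 w2 : (A, r) \in cfg_prods G ->
    yields n r w1 -> yields n.+1 s w2 -> yields n.+1 (inl A :: s) (w1 ++ w2).

Lemma yields_derives n s w : yields n s w -> derives s (terminals w).
Proof.
elim=> {n s w} [n|n a s w _ IH|n A r s w1 w2 rP _ IH1 _ IH2].
- exact: rt_refl.
- exact: (derives_cat (rt_refl _ _ [:: inr a])).
rewrite map_cat -cat1s; apply: derives_cat => //.
exact: derives_trans (derives_prod rP) IH1.
Qed.

Lemma yields_leq m n s w : yields m s w -> m <= n -> yields n s w.
Proof.
move=> sw; elim: sw n => {m s w} [m|m a s w _ IH|m A r s w1 w2 rP _ IH1 _ IH2] n.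
- by move=> _; constructor.
- by move=> mn; constructor; apply: IH.
by case: n => // n mn; apply: YieldsProd rP _ _; [apply: IH1|apply: IH2].
Qed.

Lemma yields_cat n s t w1 w2 :
  yields n s w1 -> yields n t w2 -> yields n (s ++ t) (w1 ++ w2).
Proof.
elim=> {n s w1} [//|n a s w1 _ IH tw|n A r s w1 w1' rP rw _ _ IH tw] /=.
  by constructor; apply: IH.
by rewrite -catA; apply: YieldsProd rP rw _; apply: IH.
Qed.

Lemma yields_cat_inv n s t w : yields n (s ++ t) w ->
  exists w1 w2, [/\ w = w1 ++ w2, yields n s w1 & yields n t w2].
Proof.
move Est: (s ++ t) => st stw.
elim: stw s Est => {n st w}
  [n|n a st w sw IH|n A r st w1 w2 rP rw _ sw IH] [|c s] //=.
- by move=> ->; exists [::], [::]; split=> //; constructor.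
- by move=> ->; exists [::], (a :: w); split=> //; constructor.
- move=> [-> /IH[u1 [u2 [-> su tu]]]].
  by exists (a :: u1), u2; split=> //; constructor.
- by move=> ->; exists [::], (w1 ++ w2); split=> //;
    [constructor|apply: YieldsProd rP rw sw].
- move=> [-> /IH[u1 [u2 [-> su tu]]]].
  by exists (w1 ++ u1), u2; split=> //; [rewrite catA|apply: YieldsProd rP rw su].
Qed.

Lemma yields_terminals n w : yields n (terminals w) w.
Proof. by elim: w => [|a w IH]; constructor. Qed.

(** The trees grown from [r] get the new root [A], which costs one level of height; the other trees
    keep theirs. *)
Lemma yields_step s t n w :
  cfg_step s t -> yields n t w -> yields n.+1 s w.
Proof.
case=> A r u v rP /yields_cat_inv[w1 [w' [-> uw]]].
case/yields_cat_inv=> w2 [w3 [-> rw vw]].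
apply: yields_cat; first exact: yields_leq uw _.
by apply: YieldsProd rP rw _; apply: yields_leq vw _.
Qed.

Lemma derives_yields s w : derives s (terminals w) -> exists n, yields n s w.
Proof.
move=> /clos_rt_rt1n_iff; move Et: (terminals w) => t st.
elim: st Et => {s t} [s <-|s t u st _ IH /IH[n tw]].
  by exists 0; apply: yields_terminals.
by exists n.+1; apply: yields_step st tw.
Qed.

(** The context [p], [q] and the word [z] make the loop usable inside complete derivations from the
    start symbol. *)
Definition pumpable (A : cfg_nonterm G) (x y : seq V) : Prop :=
  exists p q z,
    [/\ derives [:: inl (cfg_start G)] (terminals p ++ inl A :: terminals q),
        derives [:: inl A] (terminals x ++ inl A :: terminals y)
      & derives [:: inl A] (terminals z)].

(** The successor keeps every power positive, so that a single terminal obeys the size bound too. *)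
Definition cfg_width : nat := (\max_(P <- cfg_prods G) size P.2).+1.

Lemma size_prod A r : (A, r) \in cfg_prods G -> size r <= cfg_width.
Proof.
by move=> rP; apply: leqW; apply: (leq_bigmax_seq (F := fun P => size P.2) (A, r)).
Qed.

(* [F] plays the role of the set of nonterminals seen on the path from the root:
   a tree that is too large for its remaining nonterminals meets [F] again.
   When the nonterminal met is the root of the current tree, either the loop is
   pumpable or it can be cut out, which lowers the height. *)
Lemma yields_bounded n (F : {set cfg_nonterm G}) s w p q :
  yields n s w ->
  derives [:: inl (cfg_start G)] (terminals p ++ s ++ terminals q) ->
  [\/ exists A x y, pumpable A x y /\ x ++ y <> [::],
      size w <= size s * cfg_width ^ #|~: F|
    | exists B x z y, [/\ B \in F, w = x ++ z ++ y,
        derives s (terminals x ++ inl B :: terminals y) & yields n [:: inl B] z]].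
Proof.
(* Strong induction on the height, for all [F]; within it, induction on the forest with [F] fixed
   and the context [p], [q] free. *)
elim/ltn_ind: n F s w p q => n IHn F s w p q sw; move: p q.
have W k : 0 < cfg_width ^ k by rewrite expn_gt0.
elim: sw IHn => {n s w}
  [n _ p q _|n a s w sw IH IHn p q Ss|n A r s w1 w2 rP rw _ sw IH IHn p q Ss].
- by constructor 2.
- have Ss' : derives [:: inl (cfg_start G)]
      (terminals (rcons p a) ++ s ++ terminals q).
    by rewrite map_rcons cat_rcons.
  case: (IH IHn _ _ Ss') => [?|H|[B [x [z [y [BF -> sB Bz]]]]]].
  + by constructor 1.
  + by constructor 2; rewrite /= mulSn -add1n leq_add.
  + constructor 3; exists B, (a :: x), z, y; split=> //.
    exact: (derives_cat (rt_refl _ _ [:: inr a]) sB).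
have Aw1 : yields n.+1 [:: inl A] w1.
  by rewrite -[w1]cats0; apply: YieldsProd rP rw _; constructor.
have sdw := yields_derives sw.
have SA : derives [:: inl (cfg_start G)]
    (terminals p ++ [:: inl A] ++ terminals (w2 ++ q)).
  apply: derives_trans Ss _; rewrite map_cat.
  have := derives_ctx (terminals p ++ [:: inl A]) (terminals q) sdw.
  by rewrite -!catA.
have extend B x z y : B \in F -> w1 = x ++ z ++ y ->
    derives [:: inl A] (terminals x ++ inl B :: terminals y) ->
    yields n.+1 [:: inl B] z ->
    exists B x z y, [/\ B \in F, w1 ++ w2 = x ++ z ++ y,
      derives (inl A :: s) (terminals x ++ inl B :: terminals y)
      & yields n.+1 [:: inl B] z].
  move=> BF -> AB Bz; exists B, x, z, (y ++ w2); split=> //.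
    by rewrite -!catA.
  by have := derives_cat AB sdw; rewrite map_cat -catA.
have Ss' : derives [:: inl (cfg_start G)] (terminals (p ++ w1) ++ s ++ terminals q).
  apply: derives_trans Ss _; rewrite map_cat -catA.
  exact: (derives_ctx _ (s ++ terminals q) (yields_derives Aw1)).
case: (IH IHn _ _ Ss') => [?|H2|[B [x [z [y [BF -> sB Bz]]]]]].
- by constructor 1.
(* The rest of the forest is within its bound, so only the tree rooted at [A] remains. *)
- suff [?|H1|[B [x [z [y [BF Ew AB Bz]]]]]] :
    [\/ exists A x y, pumpable A x y /\ x ++ y <> [::],
      size w1 <= cfg_width ^ #|~: F|
    | exists B x z y, [/\ B \in F, w1 = x ++ z ++ y,
        derives [:: inl A] (terminals x ++ inl B :: terminals y)
        & yields n.+1 [:: inl B] z]].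
  + by constructor 1.
  + by constructor 2; rewrite size_cat /= mulSn leq_add.
  + by constructor 3; apply: extend Ew AB Bz.
  have [AF|AF] := boolP (A \in F).
    constructor 3; exists A, [::], w1, [::]; split=> //; first by rewrite cats0.
    exact: rt_refl.
  have Ar := derives_prod rP.
  have Sr : derives [:: inl (cfg_start G)]
      (terminals p ++ r ++ terminals (w2 ++ q)).
    by apply: derives_trans SA _; apply: derives_ctx.
  (* Adding [A] to [F] lowers the exponent by one, which pays for the at most [cfg_width] roots in
     [r]. *)
  case: (IHn n (leqnn _) (A |: F) r w1 _ _ rw Sr) => [?|H|].
  + by constructor 1.
  + constructor 2; apply: leq_trans H _.
    have -> : #|~: F| = #|~: (A |: F)|.+1.
      rewrite (cardsD1 A (~: F)) inE AF add1n; congr _.+1.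
      by apply: eq_card => B; rewrite !inE negb_or.
    by rewrite expnS leq_mul2r (size_prod rP) orbT.
  move=> [B [x [z [y [+ Ew rB Bz]]]]].
  have AB := derives_trans Ar rB.
  case/setU1P => [EB|BF]; last first.
    constructor 3; exists B, x, z, y; split=> //; exact: yields_leq Bz _.
  rewrite {B}EB in rB Bz AB.
  have [|xy] := eqVneq (x ++ y) [::]; last first.
    constructor 1; exists A, x, y; split; last exact/eqP.
    exists p, (w2 ++ q), z; split=> //; exact: yields_derives Bz.
  case: x y Ew {rB AB} => [|//] [|//]; rewrite /= cats0 => Ew _.
  rewrite -{z}Ew in Bz.
  (* The loop is empty: the lower occurrence of [A] already yields all of [w1], at height [n], and
     [F] is unchanged. *)
  case: (IHn n (leqnn _) F _ _ _ _ Bz SA) => [?|H|[B [x [y [z [? ? ? B']]]]]].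
  + by constructor 1.
  + by constructor 2; rewrite mul1n in H.
  + constructor 3; exists B, x, y, z; split=> //; exact: yields_leq B' _.
- constructor 3; exists B, (w1 ++ x), z, y; split=> //; first by rewrite -catA.
  rewrite map_cat -catA -cat1s.
  exact: derives_cat (yields_derives Aw1) sB.
Qed.

Lemma pumpable_generates A x y : pumpable A x y ->
  exists p z q, forall n,
    cfg_generates G (p ++ flatten (nseq n x) ++ z ++ flatten (nseq n y) ++ q).
Proof.
move=> [p [q [z [SA AA Az]]]]; exists p, z, q => n.
apply: derives_trans SA _.
have -> : p ++ flatten (nseq n x) ++ z ++ flatten (nseq n y) ++ q =
    p ++ (flatten (nseq n x) ++ z ++ flatten (nseq n y)) ++ q by rewrite -!catA.
rewrite -cat1s 2!map_cat; apply: derives_ctx.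
elim: n => [|n IH]; first by rewrite /= cats0.
(* The new loop is the outermost one, so its [y] comes last. *)
apply: derives_trans AA _; rewrite -cat1s (flatten_nseqSr n y) /=.
by have := derives_ctx (terminals x) (terminals y) IH; rewrite !map_cat -!catA.
Qed.

Lemma long_word_pumpable w :
  cfg_generates G w -> cfg_width ^ #|cfg_nonterm G| < size w ->
  exists A x y, pumpable A x y /\ x ++ y <> [::].
Proof.
move=> /derives_yields[n Sw] w_gt.
(* With [F] empty no nonterminal can be met again, and the exponent counts all nonterminals. *)
case: (@yields_bounded _ set0 _ _ [::] [::] Sw (rt_refl _ _ _)) => //.
  by rewrite setC0 cardsT mul1n leqNgt w_gt.
by move=> [B [x [z [y []]]]]; rewrite inE.
Qed.

End Pumping.

(** Pumped words contain all powers of [x] and of [y] as factors, and one of these two words is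
    nonempty. *)
Lemma context_free_powers (V : finType) (L : language V) :
  context_free L ->
  (forall u w, infix u w -> L w -> L u) ->
  (forall n, exists w, L w /\ n <= size w) ->
  exists v, v <> [::] /\ forall n, L (flatten (nseq n v)).
Proof.
move=> [G LG] L_infix L_long.
have [w [/LG Gw]] := L_long (cfg_width G ^ #|cfg_nonterm G|).+1.
case/(long_word_pumpable Gw) => A [x [y [/pumpable_generates[p [z [q gen]]] xy]]].
have Lx n : L (flatten (nseq n x)).
  apply: (L_infix _ _ _ ((LG _).2 (gen n))).
  by apply: infix_catl; apply: infix_catr; apply: infix_refl.
have Ly n : L (flatten (nseq n y)).
  apply: (L_infix _ _ _ ((LG _).2 (gen n))).
  by do 3 apply: infix_catl; apply: infix_catr; apply: infix_refl.
have [x0|/eqP x0] := eqVneq x [::]; last by exists x.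
by exists y; split=> // y0; rewrite x0 y0 in xy.
Qed.

(** * Regularity of the factors of a periodic word *)

Section PeriodicWord.

Variables (V : finType) (x0 : V) (v : seq V).

Let f k := nth x0 v (k %% size v).

Lemma flatten_nseq_mkseq n : flatten (nseq n v) = mkseq f (n * size v).
Proof.
elim: n => //= n ->; rewrite mulSn mkseqD; congr (_ ++ _).
  rewrite -{1}(mkseq_nth x0 v); apply/eq_in_map => k.
  rewrite mem_iota => /andP[_ kv].
  by rewrite /f modn_small.
by apply: eq_mkseq => k; rewrite /f modnDl.
Qed.

(** A subset construction on the cycle of positions of [v]: a factor may start anywhere, hence the
    full initial set, and the empty set means that no starting position fits. *)
Definition power_dfa : dfa V :=
  @Dfa V {set 'I_(size v)} setT (~: [set set0])
    (fun S a => [set ordS i | i in S & f i == a]).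

Lemma power_dfa_run (S : {set 'I_(size v)}) w :
  (foldl (@dfa_trans V power_dfa) S w != set0) =
  [exists i in S, w == mkseq (fun k => f (i + k)) (size w)].
Proof.
elim: w S => [|a w IH] S.
  by apply/set0Pn/exists_inP => [[i iS]|[i iS _]]; exists i.
rewrite /= IH; apply/exists_inP/exists_inP => [[_ /imsetP[i + ->] wE]|[i iS]].
  rewrite inE => /andP[iS /eqP fi]; exists i => //.
  rewrite -add1n mkseqD /= addn0 fi eqseq_cons eqxx {1}(eqP wE).
  by apply/eqP/eq_mkseq => k; rewrite /f /= modnDml addnA addn1.
rewrite -add1n mkseqD /= addn0 eqseq_cons => /andP[/eqP ai /eqP wE].
exists (ordS i); first by apply/imsetP; exists i; rewrite // inE iS ai /=.
by rewrite {1}wE; apply/eqP/eq_mkseq => k; rewrite /f /= modnDml addnA addn1.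
Qed.

Lemma regular_powers : v <> [::] ->
  regular (fun w => exists n, infix w (flatten (nseq n v))).
Proof.
move=> v0; have v_gt0 : 0 < size v by case: (v) v0.
exists power_dfa => w; rewrite /dfa_accept !inE power_dfa_run.
split=> [[n]|/exists_inP[i _ /eqP wE]].
  rewrite flatten_nseq_mkseq => /infix_mkseq[i wE].
  apply/exists_inP; exists (Ordinal (ltn_pmod i v_gt0)); first by rewrite inE.
  by rewrite {1}wE; apply/eqP/eq_mkseq => k; rewrite /f /= modnDml.
(* As [v] has at least one letter, this power is long enough to cover the window of length [size w]
   at [i]. *)
exists (i + size w); rewrite flatten_nseq_mkseq.
rewrite -(subnKC (leq_pmulr (i + size w) v_gt0)) -addnA !mkseqD -wE.
exact: infix_infix.
Qed.

End PeriodicWord.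

(** * Factors of infinite words and the conclusion *)

Lemma factors_infix (V : eqType) (alpha : infinite_word V) u w :
  infix u w -> factors alpha w -> factors alpha u.
Proof.
move=> uw; case: alpha => f /= [i wE]; rewrite wE in uw.
  by have [j ->] := infix_mkseq uw; exists (i + j);
    rewrite size_mkseq; apply: eq_mkseq => k; rewrite addnA.
have [j ->] := infix_mkseq uw; exists (i + Posz j)%R.
by rewrite size_mkseq; apply: eq_mkseq => k; rewrite PoszD GRing.addrA.
Qed.

Lemma factors_long (V : Type) (alpha : infinite_word V) n :
  exists w, factors alpha w /\ n <= size w.
Proof.
case: alpha => f /=.
  by exists (mkseq (fun k => f (0 + k)) n); rewrite size_mkseq; split=> //; exists 0.
by exists (mkseq (fun k => f (0 + k%:Z)%R) n); rewrite size_mkseq; split=> //;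
  exists 0%R.
Qed.

Theorem mainTheorem2 (V : finType) (alpha : infinite_word V) :
  almost_periodic alpha -> context_free (factors alpha) -> regular (factors alpha).
Proof.
move=> alpha_ap alpha_cf.
have [v [v0 Lv]] :=
  context_free_powers alpha_cf (@factors_infix _ alpha) (factors_long alpha).
(* The nonempty [v] supplies the default letter for [nth]. *)
have [x0 _] : exists x : V, true by case: (v) v0 => // x; exists x.
have [A Aw] := regular_powers x0 v0.
exists A => w; apply: iff_trans (Aw w); split=> [/alpha_ap[n [_ infw]]|[n wv]].
  (* The [n]-th power of [v] is a factor of [alpha] of length at least [n], so it contains [w]. *)
  exists n; apply: infw (Lv n) _; rewrite (flatten_nseq_mkseq x0) size_mkseq.
  by rewrite leq_pmulr //; case: (v) v0.
exact: factors_infix wv (Lv n).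
Qed.
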